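(* Let $(A,m,\sigma)$ be a braided algebra, let $i,j\ge 1$, and let $\Join_\sigma$ be the quantum quasi-shuffle product on $T(A)$. Then for any $a_1,\ldots,a_{i+j}\in A$, $$(a_1\otimes\cdots\otimes a_i)\Join_\sigma (a_{i+1}\otimes\cdots\otimes a_{i+j})=\sum_{(w,S)\in\overline{\mathfrak{S}}_{i,j}}T_{(w,S)}^\sigma(a_1\otimes \cdots\otimes a_{i+j}),$$ where $\overline{\mathfrak{S}}_{i,j}$ is the set of mixable $(i,j)$-shuffles and $T^\sigma_{(w,S)}=m_{\mathrm{cp}(S)}\circ T^\sigma_w$.
   Context: $\mathbb{K}$ is a field of characteristic $0$; everything is over $\mathbb{K}$. Algebras are associative, not necessarily unital. A braiding on a vector space $V$ is an invertible linear map $\sigma\in\mathrm{End}(V\otimes V)$ with $(\sigma\otimes \mathrm{id})(\mathrm{id}\otimes \sigma)(\sigma\otimes \mathrm{id})=(\mathrm{id}\otimes \sigma)(\sigma\otimes \mathrm{id})(\mathrm{id}\otimes \sigma)$ on $V^{\otimes 3}$. Write $\sigma_k=\mathrm{id}_V^{\otimes k-1}\otimes\sigma\otimes\mathrm{id}_V^{\otimes n-k-1}$ on $V^{\otimes n}$. A braided algebra $(A,m,\sigma)$ is an algebra $(A,m)$ with a braiding $\sigma$ on $A$ such that $(\mathrm{id}_A\otimes m)\sigma_1\sigma_2=\sigma(m\otimes\mathrm{id}_A)$ and $(m\otimes\mathrm{id}_A)\sigma_2\sigma_1=\sigma(\mathrm{id}_A\otimes m)$ on $A^{\otimes 3}$.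 $\mathfrak{S}_n$ is the symmetric group on $\{1,\dots,n\}$ (products are composition of maps, the right factor acting first), with generators $s_k=(k\ k{+}1)$. For $w\in\mathfrak{S}_n$ with reduced expression $w=s_{k_1}\cdots s_{k_l}$, put $T^\sigma_w=\sigma_{k_1}\cdots\sigma_{k_l}\in\mathrm{End}(A^{\otimes n})$ (independent of the reduced expression). For $i,j\ge1$, $\chi_{ij}\in\mathfrak{S}_{i+j}$ is the permutation with $\chi_{ij}(r)=j+r$ for $1\le r\le i$ and $\chi_{ij}(i+r)=r$ for $1\le r\le j$; $\beta_{i,j}=T^\sigma_{\chi_{ij}}:A^{\otimes i}\otimes A^{\otimes j}\to A^{\otimes j}\otimes A^{\otimes i}$, and $\beta_{0,i}=\beta_{i,0}=\mathrm{id}$. Quantum quasi-shuffle product: $\Join_\sigma$ is the bilinear product on $T(A)=\bigoplus_{n\ge0}A^{\otimes n}$ such that scalars $\lambda\in\mathbb{K}=A^{\otimes 0}$ act by $\lambda\Join_\sigma x=x\Join_\sigma\lambda=\lambda x$, and, with $\Join_{\sigma(i,j)}$ denoting its restriction to $A^{\otimes i}\otimes A^{\otimes j}$, recursively for $i,j\ge1$ (with $u=a_1\otimes\cdots\otimes a_i$ and $v=b_1\otimes\cdots\otimes b_j$): $$u\Join_\sigma v=a_1\otimes\big((a_2\otimes\cdots\otimes a_i)\Join_\sigma v\big)+(\mathrm{id}_A\otimes\Join_{\sigma(i,j-1)})(\beta_{i,1}\otimes\mathrm{id}_A^{\otimes j-1})(u\otimes v)+(m\otimes\Join_{\sigma(i-1,j-1)})(\mathrm{id}_A\otimes\beta_{i-1,1}\otimes\mathrm{id}_A^{\otimes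 j-1})(u\otimes v),$$ where an empty tensor is $1\in\mathbb{K}$. In particular $a\Join_\sigma b=a\otimes b+\sigma(a\otimes b)+m(a\otimes b)$ for $a,b\in A$. An $(i,j)$-shuffle is $w\in\mathfrak{S}_{i+j}$ with $w(1)<\cdots<w(i)$ and $w(i+1)<\cdots<w(i+j)$; $\mathfrak{S}_{i,j}$ is the set of these. For $w\in\mathfrak{S}_{i,j}$, a pair $(k,k+1)$ with $1\le k<i+j$ is admissible for $w$ if $w^{-1}(k)\le i<w^{-1}(k+1)$; $\mathcal{T}^w$ is the set of admissible pairs. $\overline{\mathfrak{S}}_{i,j}=\{(w,S)\mid w\in\mathfrak{S}_{i,j},\ S\subset\mathcal{T}^w\}$ is the set of mixable $(i,j)$-shuffles. Define $m^0=\mathrm{id}_A$, $m^1=m$, $m^k=m(\mathrm{id}_A\otimes m^{k-1}):A^{\otimes k+1}\to A$. For a composition $I=(i_1,\dots,i_k)$ of $n$ (positive integers with sum $n$), $m_I=m^{i_1-1}\otimes\cdots\otimes m^{i_k-1}$. For $(w,S)\in\overline{\mathfrak{S}}_{i,j}$ with $S=\{(k_1,k_1+1),\dots,(k_s,k_s+1)\}$, $k_1<\cdots<k_s$, $\mathrm{cp}(S)$ is the composition of $i+j$ consisting of $k_1-1$ entries $1$, then a $2$, then $k_2-k_1-2$ entries $1$, then a $2$, and so on, then the last $2$, followed by $i+j-k_s-1$ entries $1$; $\mathrm{cp}(\emptyset)=(1,\dots,1)$. *)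

(* Defs.v *)
From HB Require Import structures.
From mathcomp Require Import all_fingroup all_boot all_order all_algebra.
From mathcomp Require Import finmap boolp.
From mathcomp.multinomials Require Import monalg.

Set Implicit Arguments.
Unset Strict Implicit.
Unset Printing Implicit Defensive.

Import GRing.Theory.
Local Open Scope ring_scope.
Local Open Scope quotient_scope.

(** * Linear spans and quotient modules *)

Definition lspan (K : fieldType) (V : lmodType K) (G : V -> Prop) : {pred V} :=
  fun x => `[< exists2 s : seq (K * V), (forall p, p \in s -> G p.2) &
                 x = \sum_(p <- s) p.1 *: p.2 >].

Lemma lspan_submod_closed (K : fieldType) (V : lmodType K) (G : V -> Prop) :
  submod_closed (lspan G).
Proof.
split; first by apply/asboolP; exists [::]; rewrite ?big_nil.
move=> c x y /asboolP[s Gs ->] /asboolP[t Gt ->]; apply/asboolP.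
exists ([seq (c * p.1, p.2) | p <- s] ++ t).
  move=> p; rewrite mem_cat => /orP[/mapP[q qs ->]|/Gt //]; exact: Gs qs.
rewrite big_cat big_map scaler_sumr /=; congr (_ + _).
by apply: eq_bigr => p _; rewrite scalerA.
Qed.

HB.instance Definition _ (K : fieldType) (V : lmodType K) (G : V -> Prop) :=
  GRing.isSubmodClosed.Build K V (lspan G) (lspan_submod_closed G).

Record quot_module (K : fieldType) (V : lmodType K) (G : V -> Prop) := {
  quot_mod :> lmodType K;
  quot_pi : {linear V -> quot_mod};
  quot_repr : quot_mod -> V;
  quot_reprK : cancel quot_repr quot_pi;
  quot_ker : forall x, (quot_pi x == 0) = (x \in lspan G)
}.

(* The construction is kept opaque: a quotient is determined up to isomorphism
   by the fields above. *)
Section QuotientModule.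
Variables (K : fieldType) (V : lmodType K) (G : V -> Prop).

Local Notation Q := (Quotient.quot (lspan G)).
Let pi (x : V) : Q := \pi_Q x.

Let piP x y : reflect (pi x = pi y) (x - y \in lspan G).
Proof. by rewrite Quotient.idealrBE; exact: eqP. Qed.

Let reprK' (x : Q) : pi (repr x) = x. Proof. exact: reprK. Qed.

Let piD : {morph pi : x y / x + y}. Proof. exact: raddfD. Qed.

Let scale (c : K) (x : Q) : Q := pi (c *: repr x).

Let scaleE c x : scale c (pi x) = pi (c *: x).
Proof. by apply/piP; rewrite -scalerBr; apply: rpredZ; exact/piP/reprK'. Qed.

Let scaleA a b x : scale a (scale b x) = scale (a * b) x.
Proof. by rewrite -(reprK' x) !scaleE scalerA. Qed.

Let scale1 : left_id 1 scale.
Proof. by move=> x; rewrite -(reprK' x) scaleE scale1r. Qed.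

Let scaleDr : right_distributive scale +%R.
Proof.
move=> c x y; rewrite -(reprK' x) -(reprK' y) -piD.
by rewrite !scaleE scalerDr piD.
Qed.

Let scaleDl x : {morph scale^~ x : a b / a + b}.
Proof. by move=> a b; rewrite -(reprK' x) !scaleE scalerDl piD. Qed.

Lemma quot_module_of : quot_module G.
Proof.
pose Qm := GRing.Zmodule_isLmodule.Build K Q scaleA scale1 scaleDr scaleDl.
pose QL : lmodType K := HB.pack Q Qm.
have pi_linear : linear (pi : V -> QL) by move=> c x y; rewrite piD -scaleE.
pose piL := GRing.isLinear.Build K V QL *:%R pi pi_linear.
pose piF : {linear V -> QL} := HB.pack (pi : V -> QL) piL.
apply: (@Build_quot_module _ _ _ QL piF (fun x : QL => repr (x : Q))) => [|x].
  exact: reprK'.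
by rewrite -(linear0 piF); apply/eqP/idP => [/piP|xG]; [|apply/piP];
  rewrite subr0.
Qed.

End QuotientModule.

(** * The tensor algebra *)

(* T(A) is the free module on the words a_1 ... a_n (n >= 0) over A modulo the
   multilinearity relations.  These are homogeneous in n, so that T(A) is the
   direct sum of the A^{(x) n}. *)

Definition tensor_rel (K : fieldType) (A : lmodType K) (z : {malg K[seq A]}) :=
  exists (u v : seq A) (c : K) (x y : A),
    z = << u ++ (c *: x + y) :: v >> - c *: << u ++ x :: v >>
        - << u ++ y :: v >>.

Definition tensor (K : fieldType) (A : lmodType K) : lmodType K :=
  quot_module_of (@tensor_rel K A).

(* [pure [:: a_1; ...; a_n]] is a_1 (x) ... (x) a_n; [pure [::]] is 1. *)
Definition pure (K : fieldType) (A : lmodType K) (w : seq A) : tensor A :=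
  quot_pi (quot_module_of (@tensor_rel K A)) << w >>.

(* A^{(x) n}, as the component of degree n of T(A). *)
Record tpow (K : fieldType) (A : lmodType K) (n : nat) := TPow {
  tpow_val :> tensor A;
  _ : tpow_val \in lspan (fun x => exists2 w : seq A, size w = n & x = pure w) }.

HB.instance Definition _ (K : fieldType) (A : lmodType K) (n : nat) :=
  [isSub for @tpow_val K A n].
HB.instance Definition _ (K : fieldType) (A : lmodType K) (n : nat) :=
  [Choice of tpow A n by <:].
HB.instance Definition _ (K : fieldType) (A : lmodType K) (n : nat) :=
  [SubChoice_isSubLmodule of tpow A n by <:].

Definition multilinear (K : fieldType) (A V : lmodType K) (f : seq A -> V) :=
  forall (u v : seq A) (c : K) (x y : A),
    f (u ++ (c *: x + y) :: v) = c *: f (u ++ x :: v) + f (u ++ y :: v).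

(* The linear map on T(A) with [pure w |-> f w], for [f] multilinear. *)
Definition tlift (K : fieldType) (A V : lmodType K) (f : seq A -> V)
    (x : tensor A) : V :=
  let z := quot_repr x in \sum_(w <- msupp z) z@_w *: f w.

Section UniversalProperty.
Variables (K : fieldType) (A V : lmodType K) (f : seq A -> V).

Let lin (z : {malg K[seq A]}) : V := \sum_(w <- msupp z) z@_w *: f w.

Let linE (d : {fset seq A}) z :
  (msupp z `<=` d)%fset -> lin z = \sum_(w <- d) z@_w *: f w.
Proof.
move=> sub; rewrite /lin (big_fset_incl _ sub) // => w _ /mcoeff_outdom ->.
by rewrite scale0r.
Qed.

Let lin_linear : linear lin.
Proof.
move=> c x y.
pose d := (msupp (c *: x + y) `|` msupp x `|` msupp y)%fset.
rewrite (@linE d (c *: x + y)) ?(@linE d x) ?(@linE d y); first last.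
- by rewrite /d -fsetUA fsubsetUl.
- by rewrite /d fsetUAC fsubsetUr.
- by rewrite /d fsubsetUr.
rewrite scaler_sumr -big_split; apply: eq_bigr => w _.
by rewrite mcoeffD mcoeffZ scalerDl scalerA.
Qed.

Let linU w : lin << w >> = f w.
Proof.
rewrite (@linE [fset w]%fset) ?msuppU_le //.
by rewrite big_seq_fset1 mcoeffU eqxx scale1r.
Qed.

Hypothesis mf : multilinear f.

Let lin_rel z : z \in lspan (@tensor_rel K A) -> lin z = 0.
Proof.
pose L := GRing.isLinear.Build _ _ _ _ lin lin_linear.
pose l : {linear {malg K[seq A]} -> V} := HB.pack lin L.
rewrite -[lin z]/(l z) => /asboolP[s sG ->]; rewrite linear_sum big_seq big1 //.
move=> p /sG[u [v [c [x [y ->]]]]].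
by rewrite linearZ !linearB linearZ /= /l /= !linU mf addrAC addrK subrr scaler0.
Qed.

Let tlift_pi z : tlift f (quot_pi (quot_module_of _) z) = lin z.
Proof.
apply/subr0_eq; rewrite -[tlift f _]/(lin _).
pose L := GRing.isLinear.Build _ _ _ _ lin lin_linear.
pose l : {linear {malg K[seq A]} -> V} := HB.pack lin L.
rewrite -(raddfB l); apply: lin_rel.
by rewrite -(quot_ker (quot_module_of _)) linearB /= quot_reprK subrr.
Qed.

Lemma tlift_pure w : tlift f (pure w) = f w.
Proof. by rewrite tlift_pi linU. Qed.

Lemma tlift_linear : linear (tlift f).
Proof.
move=> c x y; rewrite -(quot_reprK x) -(quot_reprK y).
by rewrite -linearP !tlift_pi lin_linear.
Qed.
End UniversalProperty.

(* The product x (x) y of T(A). *)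
Definition tmul (K : fieldType) (A : lmodType K) (x y : tensor A) : tensor A :=
  tlift (fun u => tlift (fun v => pure (u ++ v)) y) x.

(** * Operators on T(A) *)

(* A linear map f from A^{(x) p} to T(A) is represented by an operator on T(A),
   of which only the values on A^{(x) p} are relevant. *)

(* f (x) g, where f is applied to the first p tensor factors and g to the
   remaining ones. *)
Definition tens (K : fieldType) (A : lmodType K) (p : nat)
    (f g : tensor A -> tensor A) : tensor A -> tensor A :=
  tlift (fun w => if (p <= size w)%N
                  then tmul (f (pure (take p w))) (g (pure (drop p w)))
                  else 0).

(* Extension by 0 to T(A) of a linear map defined on A^{(x) n}. *)
Definition text (K : fieldType) (A : lmodType K) (n : nat)
    (f : tpow A n -> tensor A) : tensor A -> tensor A :=
  tlift (fun w => if size w == n then f (insubd 0 (pure w)) else 0).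

Section BraidedAlgebra.
Variables (K : fieldType) (A : lmodType K).
Variables (m : {linear tpow A 2 -> A}) (sigma : {linear tpow A 2 -> tpow A 2}).

Definition sigmaT : tensor A -> tensor A := text (fun x => tpow_val (sigma x)).

(* A = A^{(x) 1} via a |-> pure [:: a]. *)
Definition mT : tensor A -> tensor A := text (fun x => pure [:: m x]).

(* id^{(x) k} (x) sigma (x) id^{(x) n-k-2} on A^{(x) n}, for k + 1 < n; this
   is sigma_{k+1} in 1-based numbering. *)
Definition sigma_at (k : nat) : tensor A -> tensor A :=
  tens k id (tens 2 sigmaT id).

Definition is_braiding : Prop :=
  bijective sigma /\
  forall x : tpow A 3,
    tens 2 sigmaT id (tens 1 id sigmaT (tens 2 sigmaT id x)) =
    tens 1 id sigmaT (tens 2 sigmaT id (tens 1 id sigmaT x)).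

Record braided_algebra : Prop := BraidedAlgebra {
  braided_assoc : forall x : tpow A 3,
    mT (tens 2 mT id x) = mT (tens 1 id mT x);
  braided_braiding : is_braiding;
  braided_mulr : forall x : tpow A 3,
    tens 1 id mT (sigma_at 0 (sigma_at 1 x)) = sigmaT (tens 2 mT id x);
  braided_mull : forall x : tpow A 3,
    tens 2 mT id (sigma_at 1 (sigma_at 0 x)) = sigmaT (tens 1 id mT x)
}.

End BraidedAlgebra.

(** * Lifts of permutations *)

(* The pair (k, k+1) of elements of {0, ..., n-1} is encoded by k : 'I_n.-1. *)
Definition pair_fst (n : nat) (k : 'I_n.-1) : 'I_n :=
  Ordinal (leq_trans (ltn_ord k) (leq_pred n)).
Definition pair_snd (n : nat) (k : 'I_n.-1) : 'I_n :=
  Ordinal (etrans (esym (ltn_predRL k n)) (ltn_ord k)).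

Definition adj_tperm (n : nat) (k : 'I_n.-1) : 'S_n :=
  tperm (pair_fst k) (pair_snd k).

(* The composite s_{k_1} o ... o s_{k_l}, with s_{k_l} acting first.  As
   [(s * t)%g] applies s first, the word is reversed. *)
Definition word_perm (n : nat) (ks : seq 'I_n.-1) : 'S_n :=
  (\prod_(k <- rev ks) adj_tperm k)%g.

Definition reduced_expr (n : nat) (w : 'S_n) (ks : seq 'I_n.-1) : Prop :=
  word_perm ks = w /\
  forall ks' : seq 'I_n.-1, word_perm ks' = w -> (size ks <= size ks')%N.

Lemma word_perm_surj (n : nat) (w : 'S_n) : exists ks, word_perm ks = w.
Proof.
have wM (s t : 'S_n) : (exists ks, word_perm ks = s) ->
    (exists ks, word_perm ks = t) -> exists ks, word_perm ks = (s * t)%g.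
  move=> [ks <-] [ls <-]; exists (ls ++ ks).
  by rewrite /word_perm rev_cat big_cat.
have w1 : exists ks : seq 'I_n.-1, word_perm ks = 1%g.
  by exists [::]; rewrite /word_perm big_nil.
have wadj (x y : 'I_n) : y = x.+1 :> nat -> exists ks, word_perm ks = tperm x y.
  move=> yE; have lt_x : (x < n.-1)%N by rewrite ltn_predRL -yE.
  exists [:: Ordinal lt_x]; rewrite /word_perm big_seq1 /adj_tperm.
  by congr (tperm _ _); apply: val_inj => //=.
have wtp d (x y : 'I_n) : y = (x + d)%N :> nat ->
    exists ks, word_perm ks = tperm x y.
  elim: d x y => [|d IHd] x y yE.
    have -> : y = x by apply: val_inj; rewrite /= yE addn0.
    by rewrite tperm1.
  have lt_z : (x + d < n)%N by have := ltn_ord y; rewrite yE addnS => /ltnW.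
  pose z := Ordinal lt_z; have yz : y = z.+1 :> nat by rewrite yE addnS.
  case: (posnP d) => [d0|d_gt0]; first by apply: wadj; rewrite yE d0 addn1.
  have xz : x != z.
    apply/eqP => /(congr1 val)/= /eqP; rewrite -{1}[val x]addn0 eqn_add2l.
    by rewrite eq_sym -leqn0 leqNgt d_gt0.
  have xy : x != y.
    by apply/eqP => /(congr1 val)/= /eqP; rewrite yE -{1}[val x]addn0 eqn_add2l.
  have -> : tperm x y = (tperm z y * tperm x z * tperm z y)%g.
    rewrite -{1}(tpermV z y) -mulgA -/(conjg _ _) tpermJ tpermL.
    by rewrite tpermD // eq_sym.
  have zyE := wadj z y yz; apply: (wM _ _ _ zyE); apply: (wM _ _ zyE).
  exact: IHd x z erefl.
have [ts -> _] := prod_tpermP w; elim: ts => [|[x y] ts IHts].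
  by rewrite big_nil.
rewrite big_cons; apply: wM => //=.
case: (leqP x y) => [le_xy|/ltnW le_yx]; last rewrite tpermC.
  by apply: (wtp (y - x)%N); rewrite subnKC.
by apply: (wtp (x - y)%N); rewrite subnKC.
Qed.

Lemma reduced_expr_exists (n : nat) (w : 'S_n) : exists ks, reduced_expr w ks.
Proof.
pose P l := `[< exists2 ks : seq 'I_n.-1, size ks = l & word_perm ks = w >].
have exP : exists l, P l.
  by have [ks wE] := word_perm_surj w; exists (size ks); apply/asboolP; exists ks.
case: (ex_minnP exP) => l /asboolP[ks szE wE] min_l; exists ks; split=> // ks'.
by move=> wE'; rewrite szE; apply: min_l; apply/asboolP; exists ks'.
Qed.

(* An arbitrary reduced expression of w. *)
Definition red_word (n : nat) (w : 'S_n) : seq 'I_n.-1 :=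
  projT1 (cid (reduced_expr_exists w)).

(* chi_{ij}; the cases [inl r] and [inr r] are those of the r-th of the first i
   and of the last j elements. *)
Definition chi_fun (i j : nat) (x : 'I_(i + j)) : 'I_(i + j) :=
  cast_ord (addnC j i)
    (match split x with inl r => rshift j r | inr r => lshift i r end).

Lemma chi_fun_inj (i j : nat) : injective (@chi_fun i j).
Proof.
move=> x y /cast_ord_inj; rewrite -{2}(splitK x) -{2}(splitK y).
case: (split x) => r; case: (split y) => s /= e.
- by rewrite (rshift_inj e).
- by move/eqP: e; rewrite eq_rlshift.
- by move/eqP: e; rewrite eq_lrshift.
- by rewrite (lshift_inj e).
Qed.

Definition chi (i j : nat) : 'S_(i + j) := perm (@chi_fun_inj i j).

(** * Mixable shuffles *)

Section MixableShuffles.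
Variables (i j : nat).

Definition is_shuffle (w : 'S_(i + j)) : bool :=
  [forall r : 'I_i, forall s : 'I_i,
     (r < s)%N ==> (w (lshift j r) < w (lshift j s))%N] &&
  [forall r : 'I_j, forall s : 'I_j,
     (r < s)%N ==> (w (rshift i r) < w (rshift i s))%N].

(* In 0-based numbering, the condition w^{-1}(k) <= i < w^{-1}(k+1) becomes
   w^{-1}(k) < i <= w^{-1}(k+1). *)
Definition admissible (w : 'S_(i + j)) : {set 'I_(i + j).-1} :=
  [set k | ((w^-1)%g (pair_fst k) < i)%N && (i <= (w^-1)%g (pair_snd k))%N].

Definition mixable : {set 'S_(i + j) * {set 'I_(i + j).-1}} :=
  [set p : 'S_(i + j) * {set 'I_(i + j).-1} |
     is_shuffle p.1 && (p.2 \subset admissible p.1)].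

End MixableShuffles.

(* The entries of cp(S) covering the positions p, ..., n-1, where [ks] lists in
   increasing order the (0-based) k >= p with (k, k+1) in S. *)
Fixpoint cp_from (n p : nat) (ks : seq nat) : seq nat :=
  if ks is k :: ks' then nseq (k - p) 1%N ++ 2 :: cp_from n k.+2 ks'
  else nseq (n - p) 1%N.

(* [enum S] is increasing. *)
Definition cp (n : nat) (S : {set 'I_n.-1}) : seq nat :=
  cp_from n 0 [seq val k | k <- enum S].

(** * The quantum quasi-shuffle product *)

Section QuasiShuffle.
Variables (K : fieldType) (A : lmodType K).
Variables (m : {linear tpow A 2 -> A}) (sigma : {linear tpow A 2 -> tpow A 2}).

Definition Tperm (n : nat) (w : 'S_n) : tensor A -> tensor A :=
  foldr (fun (k : 'I_n.-1) f => sigma_at sigma k \o f) id (red_word w).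

Definition braid (i j : nat) : tensor A -> tensor A :=
  if (0 < i)%N && (0 < j)%N then Tperm (chi i j) else id.

(* The restriction of the product to A^{(x) i} (x) A^{(x) j}, seen as a map
   from A^{(x) i+j} to T(A). *)
Fixpoint qshuffle_deg (i : nat) : nat -> tensor A -> tensor A :=
  if i is i'.+1 then
    fix qshuffle_i (j : nat) : tensor A -> tensor A :=
      if j is j'.+1 then fun x =>
        tens 1 id (qshuffle_deg i' j) x +
        tens 1 id (qshuffle_i j') (tens i.+1 (braid i 1) id x) +
        tens 2 (mT m) (qshuffle_deg i' j')
          (tens 1 id (tens i (braid i' 1) id) x)
      else id
  else fun _ => id.

Definition qshuffle (x y : tensor A) : tensor A :=
  tlift (fun u =>
    tlift (fun v => qshuffle_deg (size u) (size v) (pure (u ++ v))) y) x.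

Fixpoint mpow (k : nat) : tensor A -> tensor A :=
  match k with
  | 0 => id
  | 1 => mT m
  | k'.+1 => mT m \o tens 1 id (mpow k')
  end.

Definition mcomp (I : seq nat) : tensor A -> tensor A :=
  foldr (fun p f => tens p (mpow p.-1) f) id I.

Definition Tmix (i j : nat) (p : 'S_(i + j) * {set 'I_(i + j).-1}) :
    tensor A -> tensor A :=
  mcomp (cp p.2) \o Tperm p.1.

End QuasiShuffle.

(* Main.v *)
Require Import Defs.
From mathcomp Require Import all_fingroup all_boot all_order all_algebra.
From mathcomp Require Import finmap boolp.
From mathcomp.multinomials Require Import monalg.
From mathcomp Require Import zify.

Set Implicit Arguments.
Unset Strict Implicit.
Unset Printing Implicit Defensive.

Import GRing.Theory.
Local Open Scope ring_scope.

(** An (i,j)-shuffle w is determined by the sequence of bits telling, for each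
    place k = 0, 1, ..., whether w^{-1}(k) lies in the first block.  A mixable
    shuffle is such a sequence in which some of the adjacent pairs 10 have been
    merged; the merged pairs are disjoint, and cp(S) records them as its entries
    2.  Reading the first letter of this object from the left leaves three
    cases: an unmerged 1 (the result begins with a_1), a 0 (it begins with b_1,
    which has been moved across a_1, ..., a_i), or a merged 10 (it begins with
    the product of a_1 and b_1, the latter moved across a_2, ..., a_i).  These
    are the three terms of the recursion defining the product, so the theorem
    follows by induction on i and j ([qshuffle_deg_stuffles]), once the
    operators on both sides are matched.

    For the operators, T_w has to be computed from reduced expressions adapted
    to the recursion, whereas its definition picks an arbitrary one.  The
    reduced expressions of a shuffle are the ways of sorting its bit sequence
    by swaps 01 -> 10 of adjacent bits: a generator changes the number of bit
    inversions by at most one, and this number is attained as the length of a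
    word, so each letter of a reduced expression must remove one inversion
    ([red_word_sorts]).  Two available swaps never overlap, because their common
    bit would have to be both 0 and 1; hence they commute, and by the diamond
    argument all sorting words yield the same operator ([sorts_confluent]).
    The convenient choice, [sorting_word], shifts the word of the remaining bits
    by one place and, when the first bit is 0, lets the word of chi_{i,1} act
    before it.

    Finally [sum_mixable] turns the sum over mixable shuffles into a sum over
    the list [stuffles i j], which is built by the three cases above. *)

(** * Tensors and operators on them *)

(* Linearity is used as a property of plain functions, since the operators of
   the statement are plain functions, linear only for linear arguments. *)
Section Linear.
Variables (K : fieldType).
Implicit Types (V : lmodType K).

Lemma linear_map0 V V' (f : V -> V') : linear f -> f 0 = 0.
Proof.
move=> lf; apply: (addIr (f 0)).
by have := lf 1 0 0; rewrite !scale1r !add0r => <-.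
Qed.

Lemma linear_comb V V' (f : V -> V') I (r : seq I) (c : I -> K)
    (F : I -> V) : linear f ->
  f (\sum_(k <- r) c k *: F k) = \sum_(k <- r) c k *: f (F k).
Proof.
move=> lf; elim: r => [|k r IHr]; first by rewrite !big_nil linear_map0.
by rewrite !big_cons lf IHr.
Qed.

Lemma id_linear V : linear (@id V).
Proof. by []. Qed.

Lemma linear_comp V V' V'' (f : V' -> V'') (g : V -> V') :
  linear f -> linear g -> linear (f \o g).
Proof. by move=> lf lg c x y /=; rewrite lg lf. Qed.

Lemma linear_add V V' (f g : V -> V') :
  linear f -> linear g -> linear (fun x => f x + g x).
Proof.
by move=> lf lg c x y; rewrite lf lg scalerDr addrACA.
Qed.

Lemma linear_scale V V' c (f : V -> V') :
  linear f -> linear (fun x => c *: f x).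
Proof. by move=> lf d x y; rewrite lf scalerDr !scalerA mulrC. Qed.

Lemma linear_bigsum V V' I (r : seq I) (f : I -> V -> V') :
  (forall k, linear (f k)) -> linear (fun x => \sum_(k <- r) f k x).
Proof.
move=> lf c x y; rewrite scaler_sumr -big_split /=.
by apply: eq_bigr => k _; rewrite lf.
Qed.

End Linear.

Section Tensors.
Variables (K : fieldType) (A : lmodType K).
Implicit Types (V : lmodType K) (u v w : seq A) (x y z : tensor A).

Lemma pure_multilinear : multilinear (@pure K A).
Proof.
move=> u v c x y; apply/eqP; rewrite -subr_eq0 opprD addrA.
rewrite -linearZ -!linearB quot_ker; apply/asboolP.
exists [:: (1, << u ++ (c *: x + y) :: v >> - c *: << u ++ x :: v >>
        - << u ++ y :: v >>)].
  by move=> p; rewrite inE => /eqP->; exists u, v, c, x, y.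
by rewrite big_seq1 scale1r.
Qed.

Lemma tensor_span x :
  exists s : seq (K * seq A), x = \sum_(p <- s) p.1 *: pure p.2.
Proof.
pose z := quot_repr x; rewrite -(quot_reprK x) -/z.
exists [seq (z@_w, w) | w <- msupp z].
rewrite big_map {1}(monalgE z) linear_sum; apply: eq_bigr => w _ /=.
rewrite -linearZ /=; suff -> : << z@_w *g w >> = z@_w *: << w >> by [].
by apply/malgP => v; rewrite mcoeffZ !mcoeffU mulrnAr mulr1.
Qed.

Lemma tensor_ext V (f g : tensor A -> V) : linear f -> linear g ->
  (forall w, f (pure w) = g (pure w)) -> f =1 g.
Proof.
move=> lf lg fg x; have [s ->] := tensor_span x.
by rewrite !linear_comb //; apply: eq_bigr => p _; rewrite fg.
Qed.

Definition homog n : {pred tensor A} :=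
  lspan (fun x => exists2 w : seq A, size w = n & x = pure w).

Lemma homog_pure w : pure w \in homog (size w).
Proof.
apply/asboolP; exists [:: (1, pure w)]; last by rewrite big_seq1 scale1r.
by move=> p; rewrite inE => /eqP->; exists w.
Qed.

Lemma homog_ext n V (f g : tensor A -> V) : linear f -> linear g ->
  (forall w, size w = n -> f (pure w) = g (pure w)) -> {in homog n, f =1 g}.
Proof.
move=> lf lg fg x /asboolP[s hs ->].
rewrite !linear_comb // big_seq [RHS]big_seq; apply: eq_bigr => p ps.
by have [w sw ->] := hs p ps; rewrite fg.
Qed.

Lemma homog_map n q (f : tensor A -> tensor A) : linear f ->
  (forall w, size w = n -> f (pure w) \in homog q) ->
  {in homog n, forall x, f x \in homog q}.
Proof.
move=> lf fh x /asboolP[s hs ->]; rewrite linear_comb // big_seq.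
apply: rpred_sum => p ps; apply: rpredZ.
by have [w sw ->] := hs p ps; apply: fh.
Qed.

Lemma pure_cat_multilinear u : multilinear (fun v => pure (u ++ v) : tensor A).
Proof. by move=> u1 v1 c x y; rewrite !catA pure_multilinear. Qed.

Lemma tmul_pure u v : tmul (pure u) (pure v) = pure (u ++ v).
Proof.
have ml := pure_cat_multilinear.
rewrite /tmul tlift_pure; first by rewrite tlift_pure.
move=> u1 u2 c x y; rewrite !tlift_pure //.
by rewrite -!catA !cat_cons pure_multilinear.
Qed.

Let tmul_ml y :
  multilinear (fun u => tlift (fun v => pure (u ++ v)) y : tensor A).
Proof.
have ml := pure_cat_multilinear.
move=> u1 u2 c x1 x2; move: y; apply: tensor_ext.
- exact: tlift_linear.
- by apply: linear_add; [apply: linear_scale|]; exact: tlift_linear.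
by move=> w; rewrite !tlift_pure // -!catA !cat_cons pure_multilinear.
Qed.

Lemma tmul_linearl y : linear (fun x => tmul x y).
Proof. exact: tlift_linear. Qed.

Lemma tmul_linearr x : linear (tmul x).
Proof.
move=> c y z; move: x; apply: tensor_ext.
- exact: tmul_linearl.
- by apply: linear_add; [apply: linear_scale|]; exact: tmul_linearl.
have ml := pure_cat_multilinear.
by move=> w; rewrite /tmul !tlift_pure // tlift_linear.
Qed.

Lemma tmulA x y z : tmul x (tmul y z) = tmul (tmul x y) z.
Proof.
have l1 := tmul_linearl; have l2 := tmul_linearr.
move: x; apply: tensor_ext => // [|u]; first exact: linear_comp (l1 z) (l1 y).
move: y; apply: tensor_ext => [||v].
- exact: linear_comp (l2 _) (l1 z).
- exact: linear_comp (l1 z) (l2 _).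
move: z; apply: tensor_ext => // [|w]; first exact: linear_comp (l2 _) (l2 _).
by rewrite !tmul_pure catA.
Qed.

Lemma homog_tmul p q x y :
  x \in homog p -> y \in homog q -> tmul x y \in homog (p + q).
Proof.
move=> hx hy; apply: (homog_map (tmul_linearl y)) hx => u su.
apply: (homog_map (tmul_linearr _)) hy => v sv.
by rewrite tmul_pure -su -sv -size_cat homog_pure.
Qed.

Section Tens.
Variables (p : nat) (f g : tensor A -> tensor A).
Hypotheses (lf : linear f) (lg : linear g).

Let ml : multilinear (fun w => if (p <= size w)%N
                  then tmul (f (pure (take p w))) (g (pure (drop p w)))
                  else 0).
Proof.
move=> u v c x y; rewrite !size_cat /=; case: leqP => _; last first.
  by rewrite scaler0 addr0.
rewrite !take_cat !drop_cat; case: ltnP => [lt_p|le_p].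
  by rewrite pure_multilinear lg tmul_linearr.
case: (p - size u)%N => [|q] /=.
  by rewrite cats0 -[_ :: v]cat0s pure_multilinear lg tmul_linearr.
by rewrite pure_multilinear lf tmul_linearl.
Qed.

Lemma tens_linear : linear (tens p f g).
Proof. exact: tlift_linear. Qed.

Lemma tens_pure u v : size u = p ->
  tens p f g (pure (u ++ v)) = tmul (f (pure u)) (g (pure v)).
Proof.
move=> su; rewrite /tens tlift_pure // size_cat su leq_addr.
by rewrite -su take_size_cat // drop_size_cat.
Qed.

(** Stated for all x of degree p rather than for pure tensors, so that operators
    can be evaluated one after the other without expanding intermediate
    results. *)
Lemma tens_tmul x y : x \in homog p ->
  tens p f g (tmul x y) = tmul (f x) (g y).
Proof.
have [[l1 l2] l3] := (tmul_linearl, tmul_linearr, tens_linear).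
move=> hx; move: y; apply: tensor_ext => [||v].
- exact: linear_comp.
- exact: linear_comp.
apply: (@homog_ext p _ (fun x => tens p f g (tmul x (pure v)))
    (fun x => tmul (f x) (g (pure v))) _ _ _ x hx) => [||u su].
- exact: linear_comp l3 (l1 _).
- exact: linear_comp (l1 _) lf.
by rewrite tmul_pure tens_pure.
Qed.

Lemma homog_tens n q r : {in homog p, forall x, f x \in homog q} ->
  {in homog n, forall x, g x \in homog r} ->
  {in homog (p + n), forall x, tens p f g x \in homog (q + r)}.
Proof.
move=> hf hg; apply: homog_map; first exact: tens_linear.
move=> w sw; rewrite -(cat_take_drop p w).
have st : size (take p w) = p by rewrite size_takel // sw leq_addr.
have sd : size (drop p w) = n by rewrite size_drop sw addKn.
rewrite tens_pure //; apply: homog_tmul.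
  by apply: hf; rewrite -{2}st homog_pure.
by apply: hg; rewrite -sd homog_pure.
Qed.

End Tens.

(** Operators are compared on products of homogeneous tensors, where
    [tens_tmul] evaluates them. *)
Lemma tens_ext p n (h h' : tensor A -> tensor A) : linear h -> linear h' ->
  (forall x y, x \in homog p -> y \in homog n -> h (tmul x y) = h' (tmul x y)) ->
  {in homog (p + n), h =1 h'}.
Proof.
move=> lh lh' hh; apply: homog_ext => // w sw; rewrite -(cat_take_drop p w).
have st : size (take p w) = p by rewrite size_takel // sw leq_addr.
have sd : size (drop p w) = n by rewrite size_drop sw addKn.
rewrite -tmul_pure; apply: hh; first by rewrite -{2}st homog_pure.
by rewrite -sd homog_pure.
Qed.

Lemma text_multilinear n (f : tpow A n -> tensor A) : linear f ->
  multilinear (fun w => if size w == n then f (insubd 0 (pure w)) else 0).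
Proof.
move=> lf u v c x y; rewrite !size_cat /=; case: eqP => [sn|_]; last first.
  by rewrite scaler0 addr0.
rewrite -lf; congr f; apply: val_inj.
have hp (z : A) : pure (u ++ z :: v) \in homog n.
  by rewrite -sn -[X in homog X](size_cat u (z :: v)) homog_pure.
have hv (z : A) :
    val (insubd (0 : tpow A n) (pure (u ++ z :: v))) = pure (u ++ z :: v).
  by rewrite val_insubd hp.
rewrite linearP hv pure_multilinear.
by congr (_ *: _ + _); rewrite -[LHS]hv.
Qed.

Lemma text_pure n (f : tpow A n -> tensor A) w : linear f -> size w = n ->
  text f (pure w) = f (insubd 0 (pure w)).
Proof.
by move=> lf sw; rewrite /text tlift_pure ?sw ?eqxx //; apply: text_multilinear.
Qed.

Lemma text_linear n (f : tpow A n -> tensor A) : linear f -> linear (text f).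
Proof. by move=> lf; apply: tlift_linear; apply: text_multilinear. Qed.

End Tensors.

(** * Words in the operators sigma_k *)

Section Words.
Variables (K : fieldType) (A : lmodType K).
Variables (m : {linear tpow A 2 -> A}) (sigma : {linear tpow A 2 -> tpow A 2}).
Implicit Types (u v w : seq A) (x y z : tensor A) (ks ls : seq nat).

Let lsig : linear (fun t => tpow_val (sigma t)).
Proof. by move=> c s t; rewrite !linearP. Qed.

Lemma sigmaT_linear : linear (sigmaT sigma).
Proof. exact: text_linear lsig. Qed.

Lemma mT_linear : linear (mT m).
Proof.
apply: text_linear => c x y; rewrite linearP.
exact: (@pure_multilinear _ _ [::] [::]).
Qed.

Lemma homog_sigmaT : {in homog 2, forall x, sigmaT sigma x \in homog 2}.
Proof.
apply: homog_map sigmaT_linear _ => w sw.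
by rewrite /sigmaT (text_pure lsig sw); case: (sigma _).
Qed.

Lemma sigma_at_linear k : linear (sigma_at sigma k).
Proof.
apply: tens_linear; first exact: id_linear.
by apply: tens_linear => //; exact: sigmaT_linear.
Qed.

Lemma sigma_at_tmul k x y z : x \in homog k -> y \in homog 2 ->
  sigma_at sigma k (tmul x (tmul y z)) = tmul x (tmul (sigmaT sigma y) z).
Proof.
have lS := sigmaT_linear; move=> hx hy.
by rewrite /sigma_at !tens_tmul // => c a b; rewrite tens_linear.
Qed.

Lemma homog_sigma_at k n : (k.+2 <= n)%N ->
  {in homog n, forall x, sigma_at sigma k x \in homog n}.
Proof.
move=> le_kn; have lS := sigmaT_linear.
have -> : n = (k + (2 + (n - k.+2)))%N by lia.
apply: homog_tens => //; first exact: tens_linear.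
by apply: homog_tens => //; exact: homog_sigmaT.
Qed.

Lemma homog3_ext p q r (h h' : tensor A -> tensor A) : linear h -> linear h' ->
  (forall x y z, x \in homog p -> y \in homog q -> z \in homog r ->
     h (tmul x (tmul y z)) = h' (tmul x (tmul y z))) ->
  {in homog (p + (q + r)), h =1 h'}.
Proof.
move=> lh lh' hh; apply: tens_ext => // x yz hx; have lx := tmul_linearr x.
apply: (@tens_ext _ _ q r (fun t => h (tmul x t)) (fun t => h' (tmul x t))).
- exact: linear_comp lh lx.
- exact: linear_comp lh' lx.
by move=> y z hy hz; apply: hh.
Qed.

(** On x y x' y' z' with y in places k, k+1 and y' in places l, l+1, both sides
    replace y and y' by their images under sigma. *)
Lemma sigma_at_comm k l n : (k.+2 <= l)%N -> (l.+2 <= n)%N ->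
  {in homog n, forall x, sigma_at sigma k (sigma_at sigma l x) =
                           sigma_at sigma l (sigma_at sigma k x)}.
Proof.
move=> le_kl le_ln; have lS := sigma_at_linear.
have -> : n = (k + (2 + ((l - k.+2) + (2 + (n - l.+2)))))%N by lia.
apply: (@homog3_ext _ _ _ (sigma_at sigma k \o sigma_at sigma l)
          (sigma_at sigma l \o sigma_at sigma k)); try exact: linear_comp.
move=> x y z hx hy; have hS := homog_sigmaT hy.
pose F f t := f (tmul x (tmul y t)) : tensor A.
have lF f : linear f -> linear (F f).
  move=> lf; apply: (linear_comp lf).
  exact: linear_comp (tmul_linearr x) (tmul_linearr y).
apply: (@homog3_ext _ _ _ (F (sigma_at sigma k \o sigma_at sigma l))
    (F (sigma_at sigma l \o sigma_at sigma k))) z;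
  try by apply: lF; exact: linear_comp.
move=> x' y' z' hx' hy' _; rewrite /F /=.
have hl y1 : y1 \in homog 2 -> tmul x (tmul y1 x') \in homog l.
  move=> hy1; have -> : l = (k + (2 + (l - k.+2)))%N by lia.
  by do 2!apply: homog_tmul => //.
have E y1 t : tmul x (tmul y1 (tmul x' t)) = tmul (tmul x (tmul y1 x')) t.
  by rewrite !tmulA.
rewrite (sigma_at_tmul _ hx hy) [in RHS]E (sigma_at_tmul _ (hl _ hS) hy').
by rewrite E (sigma_at_tmul _ (hl _ hy) hy') -!E (sigma_at_tmul _ hx hy).
Qed.

Definition sigmas ks : tensor A -> tensor A :=
  foldr (fun k f => sigma_at sigma k \o f) id ks.

Lemma sigmas_cat ks ls x : sigmas (ks ++ ls) x = sigmas ks (sigmas ls x).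
Proof. by elim: ks => //= k ks ->. Qed.

Lemma sigmas_linear ks : linear (sigmas ks).
Proof.
by elim: ks => [|k ks IH] //=; apply: linear_comp IH; exact: sigma_at_linear.
Qed.

Lemma homog_sigmas n ks : all (fun k => k.+2 <= n)%N ks ->
  {in homog n, forall x, sigmas ks x \in homog n}.
Proof.
move=> hks x hx; elim: ks hks => //= k ks IH /andP[le_k hks].
exact: homog_sigma_at le_k _ (IH hks).
Qed.

(** The degree of y matters: a letter k acts on y only if y has the places k and
    k + 1. *)
Lemma sigmas_shift p n ks x y : all (fun k => k.+2 <= n)%N ks ->
  x \in homog p -> y \in homog n ->
  sigmas [seq (p + k)%N | k <- ks] (tmul x y) = tmul x (sigmas ks y).
Proof.
move=> hks hx hy; elim: ks hks => //= k ks IH /andP[le_k hks].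
have := homog_sigmas hks hy; rewrite IH //; move: (sigmas ks y).
have lS := sigma_at_linear; have lx := tmul_linearr x.
have -> : n = (k + (2 + (n - k.+2)))%N by lia.
apply: (@homog3_ext _ _ _ (sigma_at sigma (p + k) \o tmul x)
  (tmul x \o sigma_at sigma k)); try exact: linear_comp.
move=> a b c ha hb hc /=.
rewrite tmulA (sigma_at_tmul _ (homog_tmul hx ha) hb) -tmulA.
by rewrite (sigma_at_tmul _ ha hb).
Qed.

Lemma sigmas_left p ks x y : all (fun k => k.+2 <= p)%N ks ->
  x \in homog p -> sigmas ks (tmul x y) = tmul (sigmas ks x) y.
Proof.
move=> hks hx; elim: ks hks => //= k ks IH /andP[le_k hks].
have := homog_sigmas hks hx; rewrite IH //; move: (sigmas ks x).
have lS := sigma_at_linear; have ly := tmul_linearl y.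
have -> : p = (k + (2 + (p - k.+2)))%N by lia.
apply: (@homog3_ext _ _ _ (sigma_at sigma k \o (fun x => tmul x y))
  ((fun x => tmul x y) \o sigma_at sigma k)); try exact: linear_comp.
move=> a b c ha hb hc /=.
by rewrite (sigma_at_tmul _ ha hb) -!tmulA (sigma_at_tmul _ ha hb).
Qed.

End Words.

(** * Sorting words of bit sequences *)

(** [sorts ks b c]: the letters of ks, the last one first, turn c into b by swaps
    10 -> 01 at the named places.  Read from the left, ks sorts b into c by swaps
    01 -> 10.  This orientation is that of T_w, whose rightmost factor acts
    first. *)
Inductive sorts : seq nat -> bitseq -> bitseq -> Prop :=
| sorts_nil b : sorts [::] b b
| sorts_cons ks p q c : sorts ks (p ++ true :: false :: q) c ->
    sorts (size p :: ks) (p ++ false :: true :: q) c.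

Fixpoint bit_inversions (b : bitseq) : nat :=
  if b is x :: b' then
    ((if x then 0 else count id b') + bit_inversions b')%N
  else 0%N.

Section Sorting.
Implicit Types (b c d p q : bitseq) (ks ls : seq nat).

Lemma sorts_cons_inv k ks b c : sorts (k :: ks) b c ->
  exists p q, [/\ size p = k, b = p ++ false :: true :: q &
                  sorts ks (p ++ true :: false :: q) c].
Proof.
move E: (k :: ks) => ls s; case: s E => // ks' p q c' s [-> ->].
by exists p, q.
Qed.

Lemma sorts_cat ks ls b c d :
  sorts ks b c -> sorts ls c d -> sorts (ks ++ ls) b d.
Proof.
by move=> s t; elim: s t => //= ks' p q c' _ IH /IH; apply: sorts_cons.
Qed.

Lemma sorts_context p q ks b c : sorts ks b c ->
  sorts [seq (size p + k)%N | k <- ks] (p ++ b ++ q) (p ++ c ++ q).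
Proof.
elim=> [b'|ks' p' q' c' _ IH] /=; first exact: sorts_nil.
rewrite -size_cat -!catA /= catA; apply: sorts_cons.
by move: IH; rewrite -!catA.
Qed.

Lemma sorts_size ks b c : sorts ks b c -> size b = size c.
Proof. by elim=> // ks' p q c' _ <-; rewrite !size_cat. Qed.

Lemma sorts_bound ks b c :
  sorts ks b c -> all (fun k => k.+2 <= size b)%N ks.
Proof.
elim=> // ks' p q c' _ /=; rewrite !size_cat /= => ->.
by rewrite andbT; lia.
Qed.

Lemma bit_inversions_swap p q :
  bit_inversions (p ++ false :: true :: q) =
  (bit_inversions (p ++ true :: false :: q)).+1.
Proof.
elim: p => [|x p IH] /=; first by lia.
by rewrite IH addnS !count_cat.
Qed.

Lemma sorts_bit_inversions ks b c :
  sorts ks b c -> bit_inversions b = (size ks + bit_inversions c)%N.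
Proof. by elim=> // ks' p q c' _ /= E; rewrite bit_inversions_swap E. Qed.

Lemma bit_inversions_sorted (a e : nat) :
  bit_inversions (nseq a true ++ nseq e false) = 0%N.
Proof.
elim: a => //=; elim: e => //= e ->; rewrite addn0.
by elim: e.
Qed.

(** For a leading 0 the word [iota 0 a], where a is the number of bits 1, is that
    of chi_{a,1}: it acts first, and moves the first letter of the second block
    across the a letters of the first one. *)
Fixpoint sorting_word b : seq nat :=
  match b with
  | [::] => [::]
  | true :: b' => map S (sorting_word b')
  | false :: b' => map S (sorting_word b') ++ iota 0 (count id b')
  end.

Definition sorted_bits b := nseq (count id b) true ++ nseq (count negb b) false.

Lemma sorts_jump a :
  sorts (iota 0 a) (false :: nseq a true) (nseq a true ++ [:: false]).
Proof.
elim: a => [|a IH]; first exact: sorts_nil.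
have -> : iota 0 a.+1 = 0%N :: [seq (1 + k)%N | k <- iota 0 a] by rewrite -iotaDl.
apply: (@sorts_cons _ [::]).
by have := sorts_context [:: true] [::] IH; rewrite !cats0.
Qed.

Lemma sorts_sorting_word b : sorts (sorting_word b) b (sorted_bits b).
Proof.
elim: b => [|[] b IH] /=; first exact: sorts_nil.
  by have := sorts_context [:: true] [::] IH; rewrite !cats0.
apply: (@sorts_cat _ _ _ (false :: sorted_bits b)).
  by have := sorts_context [:: false] [::] IH; rewrite !cats0.
have := sorts_context [::] (nseq (count negb b) false) (sorts_jump (count id b)).
by rewrite map_id /= -catA.
Qed.

(** Positions of 01 differing by one would give the common bit both values, so
    the second 01 lies beyond the first one. *)
Lemma swaps_apart p q p' q' :
  p ++ false :: true :: q = p' ++ false :: true :: q' ->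
  (size p < size p')%N ->
  exists2 r, p' = p ++ false :: true :: r & q = r ++ false :: true :: q'.
Proof.
elim: p p' => [|x p IH] [|x' p'] //=; last first.
  by case=> -> /IH{}IH /IH[r -> ->]; exists r.
by case: p' => [|y p'] //= [<- // <- ->] _; exists p'.
Qed.

Section Confluence.
Variables (K : fieldType) (A : lmodType K).
Variable sigma : {linear tpow A 2 -> tpow A 2}.

(** Matsumoto's theorem for shuffles, by the diamond argument: if the words begin
    with letters k < l, then both swaps are available in b and commute, and a
    common sorting word xs of the sequence obtained from b by both swaps links
    k :: l :: xs to one word and l :: k :: xs to the other.  The induction is on
    the common length, which is the number of inversions of b. *)
Lemma sorts_confluent ks ls b c d : sorts ks b c -> sorts ls b d ->
  bit_inversions c = 0%N -> bit_inversions d = 0%N ->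
  {in homog (A := A) (size b), sigmas sigma ks =1 sigmas sigma ls}.
Proof.
move E: (size ks) => n.
elim: n ks ls b c d E => [|n IH] ks ls b c d sz s t c0 d0.
  have := sorts_bit_inversions s.
  rewrite (sorts_bit_inversions t) sz c0 d0 !addn0 => sz'.
  by rewrite (size0nil sz) (size0nil sz').
have: size ls = n.+1.
  have := sorts_bit_inversions s.
  by rewrite (sorts_bit_inversions t) sz c0 d0 !addn0.
case: ks sz s => // k ks [sz] s; case: ls t => // l ls t [sz'] x hx /=.
have [p [q [sp Eb s']]] := sorts_cons_inv s.
have [p' [q' [sp' Eb' t']]] := sorts_cons_inv t.
have szb u v : size (u ++ true :: false :: v) = size (u ++ false :: true :: v).
  by rewrite !size_cat.
wlog lt_kl : k l ks ls c d p q p' q' {s t} sz sz' c0 d0 sp Eb s' sp' Eb' t' /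
    (k <= l)%N => [WL|].
  case: (leqP k l) => [le|/ltnW le]; first exact: (WL _ _ _ _ c d p q p' q').
  by apply/esym; apply: (WL _ _ _ _ d c p' q' p q).
move: lt_kl; rewrite leq_eqVlt => /orP[/eqP kl|lt_kl].
  have Epq : p = p' /\ q = q'.
    move: Eb'; rewrite Eb => /eqP; rewrite eqseq_cat ?sp ?sp' // => /andP[/eqP->].
    by move=> /eqP[->].
  case: Epq t' Eb Eb' => <- <- t' Eb _; rewrite kl; congr (sigma_at _ _ _).
  by apply: (IH _ _ _ _ _ sz s' t') => //; rewrite szb -Eb.
have [r Ep' Eq] : exists2 r,
    p' = p ++ false :: true :: r & q = r ++ false :: true :: q'.
  by apply: swaps_apart; rewrite -?Eb -?Eb' ?sp ?sp'.
pose bb := p ++ true :: false :: r ++ true :: false :: q'.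
pose xs := sorting_word bb; have sx := sorts_sorting_word bb.
have s1 : sorts (l :: xs) (p ++ true :: false :: q) (sorted_bits bb).
  have := @sorts_cons xs (p ++ true :: false :: r) q' (sorted_bits bb).
  rewrite Eq -!catA /= => /(_ sx).
  by rewrite -sp' Ep' !size_cat.
have t1 : sorts (k :: xs) (p' ++ true :: false :: q') (sorted_bits bb).
  by rewrite -sp Ep' -catA /=; apply: sorts_cons.
have s0 := bit_inversions_sorted (count id bb) (count negb bb).
have -> : sigmas sigma ks x = sigmas sigma (l :: xs) x.
  by apply: (IH _ _ _ _ _ sz s' s1) => //; rewrite szb -Eb.
have -> : sigmas sigma ls x = sigmas sigma (k :: xs) x.
  by apply: (IH _ _ _ _ _ sz' t' t1) => //; rewrite szb -Eb'.
have szbb : size bb = size b by rewrite Eb Eq !size_cat /= !size_cat.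
have := sorts_bound sx; rewrite szbb => hxs.
apply: (@sigma_at_comm _ _ _ _ _ (size b)) => /=.
- by rewrite -sp -sp' Ep' size_cat /= addnS addnS; lia.
- by rewrite -sp' Eb' size_cat /=; lia.
- exact: homog_sigmas.
Qed.
End Confluence.

End Sorting.

(** * Shuffles as bit sequences *)

Section Bits.
Variables (i j : nat).
Local Notation n := (i + j)%N.
Implicit Types (w : 'S_n) (k : 'I_n.-1).

Definition bits w : bitseq := [seq ((w^-1)%g x < i)%N | x <- enum 'I_n].

Lemma size_bits w : size (bits w) = n.
Proof. by rewrite size_map size_enum_ord. Qed.

Lemma nth_bits x0 w (k : 'I_n) : nth x0 (bits w) k = ((w^-1)%g k < i)%N.
Proof. by rewrite (nth_map k) ?size_enum_ord // nth_ord_enum. Qed.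

Lemma bits1 : bits 1 = nseq i true ++ nseq j false.
Proof.
apply: (@eq_from_nth _ false); rewrite size_bits ?size_cat ?size_nseq //.
move=> l lt_l; rewrite (nth_bits _ _ (Ordinal lt_l)) invg1 perm1 /=.
rewrite nth_cat size_nseq !nth_nseq; case: ltnP => // le_l.
by case: ifP.
Qed.

(** [w * adj_tperm k] is s_k o w, which exchanges the origins of the places k and
    k + 1. *)
Lemma bits_adj w k : exists p q x y,
  [/\ size p = k, bits w = p ++ x :: y :: q &
      bits (w * adj_tperm k) = p ++ y :: x :: q].
Proof.
set b := bits w; have lt_k : (k.+1 < n)%N by have := ltn_ord k; lia.
have sp : size (take k b) = k by rewrite size_takel // size_bits; lia.
exists (take k b), (drop k.+2 b), (nth false b k), (nth false b k.+1).
split=> //.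
  by rewrite -!drop_nth ?cat_take_drop // size_bits; lia.
apply: (@eq_from_nth _ false) => [|l].
  by rewrite !size_cat sp /= size_drop !size_bits; lia.
have nb e (lt_e : (e < n)%N) : nth false b e = ((w^-1)%g (Ordinal lt_e) < i)%N.
  exact: (nth_bits _ _ (Ordinal lt_e)).
rewrite size_bits => lt_l; rewrite [LHS](nth_bits _ _ (Ordinal lt_l)).
rewrite invMg tpermV permM nth_cat sp; case: (ltnP l k) => [lt_lk|le_kl].
  rewrite nth_take // (nb _ lt_l) tpermD //;
    by apply/eqP => /(congr1 val) /=; lia.
case E: (l - k)%N => [|[|e]] /=.
- have -> : Ordinal lt_l = pair_fst k by apply: val_inj => /=; lia.
  by rewrite tpermL; exact/esym/(nth_bits _ _ (pair_snd k)).
- have -> : Ordinal lt_l = pair_snd k by apply: val_inj => /=; lia.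
  by rewrite tpermR; exact/esym/(nth_bits _ _ (pair_fst k)).
have el : l = (k.+2 + e)%N by lia.
rewrite nth_drop -el (nb _ lt_l) tpermD //;
  by apply/eqP => /(congr1 val) /=; lia.
Qed.

Lemma word_perm_cons k (ks : seq 'I_n.-1) :
  word_perm (k :: ks) = (word_perm ks * adj_tperm k)%g.
Proof. by rewrite /word_perm rev_cons -cats1 big_cat big_seq1. Qed.

(** A letter changes the number of inversions of the bits by -1, 0 or 1, so a word
    as long as that number must gain one inversion with each letter. *)
Lemma bit_inversions_word (ks : seq 'I_n.-1) :
  (bit_inversions (bits (word_perm ks)) <= size ks)%N /\
  (bit_inversions (bits (word_perm ks)) = size ks ->
   sorts (map val ks) (bits (word_perm ks)) (bits 1)).
Proof.
elim: ks => [|k ks [IH1 IH2]].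
  have -> : word_perm [::] = 1%g :> 'S_n by rewrite /word_perm big_nil.
  rewrite {1}bits1 bit_inversions_sorted; split=> // _; exact: sorts_nil.
rewrite word_perm_cons; move: (word_perm ks) IH1 IH2 => w IH1 IH2.
have [p [q [x [y [sp Ew ->]]]]] := bits_adj w k.
move: IH1 IH2; rewrite Ew; case: x y {Ew} => [] [] IH1 IH2 /=.
- by split=> [|E]; lia.
- rewrite bit_inversions_swap; split=> // -[/IH2 s].
  by rewrite -sp; apply: sorts_cons.
- move: IH1; rewrite bit_inversions_swap => IH1.
  by split=> [|E]; lia.
- by split=> [|E]; lia.
Qed.

Lemma is_shuffleP w : reflect
  (forall x y : 'I_n, (x < y)%N -> (x < i)%N = (y < i)%N -> (w x < w y)%N)
  (is_shuffle w).
Proof.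
apply: (iffP andP) => [[/forallP h1 /forallP h2] x y|h].
  case: (split_ordP x) => r ->; case: (split_ordP y) => s -> /=.
  - by move=> lt_rs _; have /forallP/(_ s)/implyP := h1 r; apply.
  - by have := ltn_ord r; lia.
  - by have := ltn_ord s; lia.
  by move=> lt_rs _; have /forallP/(_ s)/implyP := h2 r; apply; lia.
split; apply/forallP => r; apply/forallP => s; apply/implyP => lt_rs; apply: h.
- by [].
- by rewrite /= !ltn_ord.
- by rewrite /=; lia.
by rewrite /=; lia.
Qed.

Lemma shuffle1 : is_shuffle (1%g : 'S_n).
Proof. by apply/is_shuffleP => x y; rewrite !perm1. Qed.

Lemma adj_tperm_lt k (x y : 'I_n) : (x < y)%N ->
  ~ (x = pair_fst k /\ y = pair_snd k) -> (adj_tperm k x < adj_tperm k y)%N.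
Proof.
move=> lt_xy ne; rewrite /adj_tperm.
case: tpermP => [xE|xE|/eqP x1 /eqP x2]; case: tpermP => [yE|yE|/eqP y1 /eqP y2];
  rewrite /= ?xE ?yE in lt_xy *; try (by move: lt_xy => /=; lia).
- by case: ne.
- by move: lt_xy y1 y2; rewrite -!val_eqE /=; lia.
by move: lt_xy x1 x2; rewrite -!val_eqE /=; lia.
Qed.

Lemma shuffle_adj w k : is_shuffle w -> ((w^-1)%g (pair_fst k) < i)%N ->
  (i <= (w^-1)%g (pair_snd k))%N -> is_shuffle (w * adj_tperm k)%g.
Proof.
move=> /is_shuffleP h lt_k le_k; apply/is_shuffleP => x y lt_xy eq_xy.
rewrite !permM; apply: adj_tperm_lt; first exact: h.
case=> xE yE; move: lt_k le_k; rewrite -xE -yE !permK; lia.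
Qed.

(** The sorting words of b spell a shuffle with bits b: a swap exchanges adjacent
    values coming from different blocks, which keeps both blocks increasing. *)
Lemma sorts_shuffle ks b : sorts ks b (bits 1) -> exists ks' : seq 'I_n.-1,
  [/\ map val ks' = ks, bits (word_perm ks') = b & is_shuffle (word_perm ks')].
Proof.
move E: (bits 1) => c s; elim: s E => [b' <-|ks' p q c' s IH /[dup] /IH].
  exists [::]; rewrite /word_perm big_nil; split=> //; exact: shuffle1.
case=> ls [<- Eb sh] Ec; have := sorts_size s; rewrite -Ec size_bits.
rewrite size_cat /= => szn.
have lt_p : (size p < n.-1)%N by lia.
exists (Ordinal lt_p :: ls); set k := Ordinal lt_p.
rewrite word_perm_cons.
have [p' [q' [x [y [sp' Ew Ew']]]]] := bits_adj (word_perm ls) k.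
move: Ew; rewrite Eb => /eqP; rewrite eqseq_cat ?sp' //.
case/andP => /eqP-> /eqP[xE yE qE].
split; [by rewrite /= sp' | by rewrite Ew' -xE -yE qE | ].
apply: shuffle_adj => //; rewrite -?(nth_bits false) ?Eb.
  by rewrite nth_cat /= ltnn subnn.
rewrite leqNgt -(nth_bits true) Eb nth_cat /= ltnNge leqnSn /=.
by rewrite subSnn.
Qed.

(** The permutation w'^{-1} w preserves the two blocks and increases on each, so
    it cannot move any point down. *)
Lemma shuffle_le w w' : is_shuffle w -> is_shuffle w' -> bits w = bits w' ->
  forall x : 'I_n, (x <= (w'^-1)%g (w x))%N.
Proof.
move=> /is_shuffleP h /is_shuffleP h' E.
have blk (x : 'I_n) : ((w'^-1)%g (w x) < i)%N = (x < i)%N.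
  by rewrite -(nth_bits false) -E nth_bits permK.
have mono (x y : 'I_n) : (x < y)%N -> (x < i)%N = (y < i)%N ->
    ((w'^-1)%g (w x) < (w'^-1)%g (w y))%N.
  move=> lt_xy eq_xy; rewrite ltnNge leq_eqVlt; apply/norP; split.
    rewrite val_eqE !(inj_eq perm_inj); apply/eqP => yx.
    by rewrite yx ltnn in lt_xy.
  apply/negP => lt_yx; have := h' _ _ lt_yx.
  rewrite !blk !permKV => /(_ (esym eq_xy)).
  by have := h _ _ lt_xy eq_xy; lia.
case=> x; elim: x => [//|x IH] lt_x.
have [xi|ne_xi] := eqVneq x.+1 i.
  by have := blk (Ordinal lt_x) => /=; lia.
have lt_x' : (x < n)%N by lia.
have /= := mono (Ordinal lt_x') (Ordinal lt_x).
have /= := IH lt_x'; lia.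
Qed.

Lemma bits_inj w w' :
  is_shuffle w -> is_shuffle w' -> bits w = bits w' -> w = w'.
Proof.
move=> sh sh' E; apply/perm.permP => x.
apply: (@perm_inj _ (w'^-1)%g); rewrite permK; apply/val_inj/eqP => /=.
have := shuffle_le sh sh' E x.
have := shuffle_le sh' sh (esym E) ((w'^-1)%g (w x)); rewrite permKV permK.
by lia.
Qed.

Lemma count_bits w : count id (bits w) = i /\ count negb (bits w) = j.
Proof.
have Eb (v : 'S_n) : bits v =
    [seq (x < i)%N | x : 'I_n <- [seq (v^-1)%g x | x <- enum 'I_n]].
  by rewrite -map_comp.
have pe (v : 'S_n) : perm_eq [seq (v^-1)%g x | x <- enum 'I_n] (enum 'I_n).
  apply: uniq_perm; last 1 first.
  - by move=> x; rewrite mem_enum -{1}(permK v x) map_f ?mem_enum.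
  - by rewrite (map_inj_uniq perm_inj) enum_uniq.
  exact: enum_uniq.
have /permP pc : perm_eq (bits w) (bits 1).
  rewrite !Eb; apply: perm_map; apply: perm_trans (pe w) _.
  by rewrite perm_sym pe.
rewrite !pc bits1 !count_cat !count_nseq /=; lia.
Qed.

Lemma exists_shuffle b : count id b = i -> count negb b = j ->
  exists2 w, is_shuffle w & bits w = b.
Proof.
move=> ci cj; have := sorts_sorting_word b; rewrite /sorted_bits ci cj -bits1.
by case/sorts_shuffle => ks [_ Eb sh]; exists (word_perm ks).
Qed.

(** Some word of w has as many letters as w has bit inversions, so the reduced
    one is not longer, and [bit_inversions_word] applies to it. *)
Lemma red_word_sorts w : is_shuffle w ->
  sorts (map val (red_word w)) (bits w) (bits 1).
Proof.
move=> sh; rewrite /red_word; case: cid => ks /= [Ew min].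
have [ci cj] := count_bits w.
have := sorts_sorting_word (bits w); rewrite /sorted_bits ci cj -bits1 => s.
have [ls [Els Eb sh']] := sorts_shuffle s.
have El := bits_inj sh' sh Eb.
have := sorts_bit_inversions s.
rewrite [in bit_inversions (bits 1)]bits1 bit_inversions_sorted addn0.
rewrite -Els size_map => E.
have := bit_inversions_word ks; rewrite Ew E => -[le_s]; apply.
by apply/eqP; rewrite eqn_leq le_s min.
Qed.

End Bits.

(** * Mixable shuffles as pairs of a bit sequence and a composition *)

(** The pairs (bits w, cp(S)) for the mixable (i,j)-shuffles (w, S), enumerated by
    the three cases of the recursion of the product. *)
Fixpoint stuffles (i : nat) : nat -> seq (bitseq * seq nat) :=
  if i is i'.+1 then
    fix stuffles_i (j : nat) :=
      if j is j'.+1 then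
        [seq (true :: q.1, 1%N :: q.2) | q <- stuffles i' j] ++
        [seq (false :: q.1, 1%N :: q.2) | q <- stuffles_i j'] ++
        [seq ([:: true, false & q.1], 2%N :: q.2) | q <- stuffles i' j']
      else [:: (nseq i true, nseq i 1%N)]
  else fun j => [:: (nseq j false, nseq j 1%N)].

(** Whether I is a composition of the length of b into parts 1 and 2, in which
    the parts 2 cover pairs 10. *)
Fixpoint fits (b : bitseq) (I : seq nat) : bool :=
  match I, b with
  | [::], [::] => true
  | 1 :: I', _ :: b' => fits b' I'
  | 2 :: I', [:: true, false & b'] => fits b' I'
  | _, _ => false
  end.

Section Stuffles.
Implicit Types (b : bitseq) (I ks : seq nat) (p i j : nat).

Lemma fits_const e b I (x : bool) :
  ((b, I) == (nseq e x, nseq e 1%N)) =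
  [&& fits b I, count (pred1 x) b == e & count (pred1 (~~ x)) b == 0%N].
Proof.
elim: e b I => [|e IH] [|y b] [|[|[|[|k]]] I] //=; rewrite ?xpair_eqE ?andbF //.
- by case: x y => [] [] /=; rewrite ?andbF.
- by case: x y => [] [] /=; rewrite ?andbF //;
    case: b => [|[] b] //=; rewrite ?andbF.
- rewrite !eqseq_cons /=; have := IH b I; rewrite xpair_eqE.
  by case: x y {IH} => [] [] /=; rewrite ?andbF ?add0n ?add1n ?eqSS //.
by case: x y {IH} => [] [] /=; rewrite ?andbF //;
  case: b => [|[] b] //=; rewrite ?andbF.
Qed.

Lemma mem_stuffles i j b I :
  ((b, I) \in stuffles i j) = [&& fits b I, count id b == i & count negb b == j].
Proof.
have ct c : count (pred1 true) c = count id c by apply: eq_count => - [].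
have cf c : count (pred1 false) c = count negb c by apply: eq_count => - [].
elim: i j b I => [|i IHi] j b I.
  by rewrite inE fits_const ct cf [X in _ && X]andbC.
elim: j b I => [|j IHj] b I; first by rewrite inE fits_const /= ct cf.
have -> : stuffles i.+1 j.+1 =
    [seq (true :: q.1, 1%N :: q.2) | q <- stuffles i j.+1] ++
    [seq (false :: q.1, 1%N :: q.2) | q <- stuffles i.+1 j] ++
    [seq ([:: true, false & q.1], 2%N :: q.2) | q <- stuffles i j] by [].
rewrite !mem_cat; apply/or3P/and3P => [[] /mapP[[c J] hq [-> ->]]|[hf hi hj]].
- by move: hq; rewrite IHi => /and3P[].
- by move: hq; rewrite IHj => /and3P[].
- by move: hq; rewrite IHi => /and3P[].
case: I hf => [|[|[|[|k]]] I]; case: b hi hj => [|x b] //=.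
  case: x => /=; rewrite ?add0n ?add1n ?eqSS => hi hj hf.
    by constructor 1; apply/mapP; exists (b, I); rewrite // IHi hf hi hj.
  by constructor 2; apply/mapP; exists (b, I); rewrite // IHj hf hi hj.
case: x => //; case: b => [|[] b] //=; rewrite ?add0n ?add1n ?eqSS => hi hj hf.
by constructor 3; apply/mapP; exists (b, I); rewrite // IHi hf hi hj.
Qed.

Lemma uniq_stuffles i j : uniq (stuffles i j).
Proof.
elim: i j => [|i IHi] j //; elim: j => [|j IHj] //.
rewrite [stuffles _ _]/= !cat_uniq !map_inj_uniq ?IHi ?IHj //=; first last.
- by move=> [b I] [b' I'] /= [-> ->].
- by move=> [b I] [b' I'] /= [-> ->].
- by move=> [b I] [b' I'] /= [-> ->].
rewrite !andbT; apply/andP; split.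
  apply/hasPn => q; rewrite mem_cat => /orP[] /mapP[r _ ->];
    by apply/negP => /mapP[].
by apply/hasPn => q /mapP[r _ ->]; apply/negP => /mapP[].
Qed.

(** The increasing lists of places carrying a pair 10, where the bits of b occupy
    the places p, p + 1, ...; the default values of [nth] exclude the places
    beyond the end of b. *)
Definition merge_places b p ks :=
  sorted ltn ks && all (fun k => [&& (p <= k)%N, nth false b (k - p)
                                  & ~~ nth true b (k - p).+1]) ks.

(** The inverse of [cp_from]. *)
Fixpoint two_positions (p : nat) I : seq nat :=
  match I with
  | [::] => [::]
  | 2 :: I' => p :: two_positions p.+2 I'
  | _ :: I' => two_positions p.+1 I'
  end.

Lemma cp_from_skip n p ks : (p < n)%N -> all (fun k => p < k)%N ks ->
  cp_from n p ks = 1%N :: cp_from n p.+1 ks.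
Proof.
case: ks => [|k ks] /=.
  by move=> lt_p _; have -> : (n - p)%N = (n - p.+1).+1 by lia.
by move=> _ /andP[lt_k _]; have -> : (k - p)%N = (k - p.+1).+1 by lia.
Qed.

Lemma cp_fromK b p ks : merge_places b p ks ->
  fits b (cp_from (p + size b) p ks) /\
  two_positions p (cp_from (p + size b) p ks) = ks.
Proof.
move E: (size b) => s; elim/ltn_ind: s b p ks E => s IH b p ks szb /andP[srt hks].
case: (altP (@allP _ (fun k => p < k)%N ks)) => [/allP lt_ks|/allPn[k k_ks]];
  last first.
  rewrite -leqNgt => le_kp.
  case: ks srt hks k_ks => // l ks srt /= /andP[/and3P[le_pl hl hl'] hks] k_ks.
  have {k k_ks le_kp} E : l = p.
    move: k_ks; rewrite inE => /orP[/eqP E|k_ks]; first by lia.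
    have /allP/(_ _ k_ks) := order_path_min ltn_trans srt; lia.
  move: srt hl hl' hks; rewrite {}E subnn /=.
  case: b szb => // x [|y b] //= szb srt; case: x => // _; case: y => // _ hks.
  have := IH (size b) _ b p.+2 ks erefl; case; first by lia.
    apply/andP; split; first exact: path_sorted srt.
    apply/allP => k k_ks; have /and3P[le_k hk hk'] := allP hks _ k_ks.
    have := allP (order_path_min ltn_trans srt) _ k_ks => lt_pk.
    case Ee: (k - p)%N hk hk' => [|[|e]] //= hk hk'; first by lia.
    by rewrite (_ : k - p.+2 = e)%N ?hk ?hk' ?andbT; lia.
  have -> : (p.+2 + size b = p + s)%N by lia.
  by move=> -> ->.
case: b szb hks => [|x b] /= szb hks.
  case: ks srt lt_ks hks => [|k ks] srt //=.
    by rewrite -szb addn0 subnn.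
  by rewrite !andbF.
rewrite cp_from_skip //; last by lia.
have := IH (size b) _ b p.+1 ks erefl; case; first by lia.
  apply/andP; split=> //; apply/allP => k k_ks.
  have /and3P[le_k hk hk'] := allP hks _ k_ks.
  have := allP lt_ks _ k_ks => lt_pk.
  have Ek : (k - p = (k - p.+1).+1)%N by lia.
  by move: hk hk'; rewrite Ek /= => -> ->; rewrite lt_pk.
have -> : (p.+1 + size b = p + s)%N by lia.
by [].
Qed.

Lemma two_positionsK b p I : fits b I ->
  merge_places b p (two_positions p I) /\
  cp_from (p + size b) p (two_positions p I) = I.
Proof.
elim: I b p => [|[|[|[|k]]] I IH] b p /=; try by case: b.
- by case: b => // _; rewrite addn0 subnn.
- case: b => // x b /(IH _ p.+1)[/andP[srt hks] cpE].
  have lt_ks : all (fun k => p < k)%N (two_positions p.+1 I).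
    by apply: sub_all hks => k /and3P[].
  split; last by rewrite cp_from_skip //= ?addnS ?ltnS ?leq_addr // -addSn cpE.
  rewrite /merge_places srt /=; apply: sub_all hks => k /and3P[lt_k hk hk'].
  have -> : (k - p = (k - p.+1).+1)%N by lia.
  by rewrite /= hk hk' (ltnW lt_k).
- case: b => [|[] [|[] b]] // /(IH _ p.+2)[/andP[srt hks] cpE].
  split; last by rewrite /= subnn /= !addnS -!addSn cpE.
  apply/andP; split.
    rewrite /= path_min_sorted //.
    by apply: sub_all hks => k /and3P[lt_k _ _] /=; lia.
  rewrite /= leqnn subnn /=; apply: sub_all hks => k /and3P[lt_k hk hk'].
  have -> : (k - p = (k - p.+2).+2)%N by lia.
  by rewrite /= hk hk'; lia.
Qed.

End Stuffles.

Section Mixable.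
Variables (i j : nat).
Local Notation n := (i + j)%N.

Definition encode (q : 'S_n * {set 'I_n.-1}) : bitseq * seq nat :=
  (bits q.1, cp q.2).

Lemma sorted_enum_set (S : {set 'I_n.-1}) : sorted ltn [seq val k | k <- enum S].
Proof.
rewrite sorted_map; apply: sorted_filter; first by move=> x y z; apply: ltn_trans.
rewrite -enumT; have := iota_ltn_sorted 0 n.-1; rewrite -val_enum_ord sorted_map.
by [].
Qed.

Lemma merge_places_admissible w (S : {set 'I_n.-1}) :
  (S \subset admissible w) = merge_places (bits w) 0 [seq val k | k <- enum S].
Proof.
rewrite /merge_places sorted_enum_set /= all_map.
apply/subsetP/allP => [sub k|hS k kS].
  rewrite mem_enum => /sub; rewrite inE => /andP[lt_k le_k] /=.
  rewrite subn0 -[nat_of_ord k]/(val (pair_fst k)) nth_bits lt_k.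
  by rewrite -[(val _).+1]/(val (pair_snd k)) nth_bits -leqNgt.
have := hS k; rewrite mem_enum => /(_ kS) /=; rewrite subn0 inE.
rewrite -[nat_of_ord k]/(val (pair_fst k)) nth_bits.
by rewrite -[(val _).+1]/(val (pair_snd k)) nth_bits -leqNgt.
Qed.

Lemma encode_inj : {in mixable i j &, injective encode}.
Proof.
move=> [w S] [w' S']; rewrite !inE /= => /andP[sh sub] /andP[sh' sub'] [Eb Ecp].
have Ew := bits_inj sh sh' Eb; rewrite -{}Ew {w' Eb} in sh' sub' *.
congr (_, _); move: sub sub'; rewrite !merge_places_admissible //.
move=> /cp_fromK[_ twS] /cp_fromK[_ twS'].
have ES : [seq val k | k <- enum S] = [seq val k | k <- enum S'].
  by rewrite -twS -twS' size_bits add0n -/(cp S) -/(cp S') Ecp.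
by apply/setP => k; rewrite -[LHS]mem_enum -[RHS]mem_enum (inj_map val_inj ES).
Qed.

Lemma mem_encode q : (q \in [seq encode p | p <- enum (mixable i j)]) =
  (q \in stuffles i j).
Proof.
case: q => b I; rewrite mem_stuffles; apply/mapP/and3P.
  move=> [[w S]]; rewrite mem_enum inE /= => /andP[sh].
  rewrite merge_places_admissible // => /cp_fromK[hf _] [-> ->].
  have [-> ->] := count_bits w; split=> //.
  by move: hf; rewrite size_bits add0n.
move=> [hf /eqP ci /eqP cj]; have [w sh Eb] := exists_shuffle ci cj.
have [hd cpE] := two_positionsK 0 hf.
pose S := [set k : 'I_n.-1 | val k \in two_positions 0 I].
have ES : [seq val k | k <- enum S] = two_positions 0 I.
  apply: (irr_sorted_eq ltn_trans ltnn) => [||k].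
  - exact: sorted_enum_set.
  - by case/andP: hd.
  apply/mapP/idP => [[l]|k_I]; first by rewrite mem_enum inE => ? ->.
  have /and3P[_ hk hk'] := allP (andP hd).2 _ k_I.
  have lt_k : (k < n.-1)%N.
    rewrite -(size_bits w) Eb; move: hk'; rewrite subn0.
    by case: (leqP (size b) k.+1) => [le|]; [rewrite nth_default | lia].
  by exists (Ordinal lt_k); rewrite // mem_enum inE.
exists (w, S).
  by rewrite mem_enum inE /= sh merge_places_admissible // ES Eb.
by rewrite /encode /cp ES -{1}cpE add0n -Eb size_bits.
Qed.

Lemma sum_mixable (V : zmodType) (F : bitseq * seq nat -> V) :
  \sum_(q in mixable i j) F (encode q) = \sum_(q <- stuffles i j) F q.
Proof.
rewrite -big_enum /= -(big_map encode xpredT F); apply: perm_big.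
apply: uniq_perm; last exact: mem_encode; last exact: uniq_stuffles.
rewrite map_inj_in_uniq ?enum_uniq // => p q.
by rewrite !mem_enum; apply: encode_inj.
Qed.

End Mixable.

(** * Expansion of the quantum quasi-shuffle product *)

Section Product.
Variables (K : fieldType) (A : lmodType K).
Variables (m : {linear tpow A 2 -> A}) (sigma : {linear tpow A 2 -> tpow A 2}).
Implicit Types (x y z : tensor A) (b : bitseq) (I ks : seq nat).

Lemma mpow_linear k : linear (mpow m k).
Proof.
elim: k => [|[|k] IH]; [exact: id_linear | exact: mT_linear |].
by apply: linear_comp; [exact: mT_linear | apply: tens_linear].
Qed.

Lemma mcomp_linear I : linear (mcomp m I).
Proof.
elim: I => [|p I IH]; first exact: id_linear.
by apply: tens_linear IH; exact: mpow_linear.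
Qed.

Lemma TpermE n (w : 'S_n) : Tperm sigma w = sigmas sigma (map val (red_word w)).
Proof. by rewrite /Tperm /sigmas; elim: (red_word w) => //= k ks ->. Qed.

Lemma Tperm_bits i j (w : 'S_(i + j)) : is_shuffle w ->
  {in homog (i + j), Tperm sigma w =1 sigmas sigma (sorting_word (bits w))}.
Proof.
move=> sh x hx; rewrite TpermE.
apply: (sorts_confluent sigma (red_word_sorts sh) (sorts_sorting_word _)).
- by rewrite bits1 bit_inversions_sorted.
- exact: bit_inversions_sorted.
by rewrite size_bits.
Qed.

Lemma chi_shuffle i j : is_shuffle (chi i j).
Proof.
apply/is_shuffleP => x y; rewrite !permE /chi_fun.
case: split_ordP => r ->; case: split_ordP => s -> /=; lia.
Qed.

Lemma bits_chi1 i : bits (chi i 1) = false :: nseq i true.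
Proof.
apply: (@eq_from_nth _ false); rewrite size_bits ?addn1 //= ?size_nseq //.
move=> l lt_l; have lt_l' : (l < i + 1)%N by rewrite addn1.
rewrite (nth_bits _ _ (Ordinal lt_l')).
case: l lt_l lt_l' => [|l] lt_l lt_l' /=.
  have -> : Ordinal lt_l' = chi i 1 (rshift i ord0).
    apply: val_inj; rewrite permE /chi_fun /=.
    by have := unsplitK (inr ord0 : 'I_i + 'I_1) => /= ->.
  by rewrite permK /= ltnNge leq_addr.
have -> : Ordinal lt_l' = chi i 1 (lshift 1 (Ordinal (lt_l : (l < i)%N))).
  apply: val_inj; rewrite permE /chi_fun /=.
  by have := unsplitK (inl (Ordinal (lt_l : (l < i)%N)) : 'I_i + 'I_1) => /= ->.
by rewrite permK /= nth_nseq (lt_l : (l < i)%N).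
Qed.

Lemma braid_linear i j : linear (braid sigma i j).
Proof.
rewrite /braid; case: ifP => _; last exact: id_linear.
by rewrite TpermE; exact: sigmas_linear.
Qed.

Lemma braid1E i :
  {in homog i.+1, braid sigma i 1 =1 sigmas sigma (iota 0 i)}.
Proof.
case: i => [|i] x hx //; rewrite /braid /= Tperm_bits ?chi_shuffle ?addn1 //.
have sw a : sorting_word (nseq a true) = [::] by elim: a => //= a ->.
rewrite bits_chi1.
have -> : sorting_word (false :: nseq i.+1 true) =
  map S (sorting_word (nseq i.+1 true)) ++ iota 0 (count id (nseq i.+1 true)) by [].
by rewrite sw count_nseq [(_ * _)%N]mul1n.
Qed.

Lemma qshuffle_deg_linear i j : linear (qshuffle_deg m sigma i j).
Proof.
elim: i j => [|i IHi] j; first exact: id_linear.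
elim: j => [|j IHj]; first exact: id_linear.
have hb := braid_linear; have hm := mT_linear m.
apply: linear_add; first apply: linear_add.
- by apply: tens_linear.
- apply: (linear_comp (f := tens 1 id _)); first exact: tens_linear.
  by apply: tens_linear.
apply: (linear_comp (f := tens 2 _ _)); first exact: tens_linear.
by apply: tens_linear => //; apply: tens_linear.
Qed.

Lemma tens_congr p n (f g h : tensor A -> tensor A) :
  linear f -> linear g -> linear h -> {in homog n, g =1 h} ->
  {in homog (p + n), tens p f g =1 tens p f h}.
Proof.
move=> lf lg lh gh; apply: tens_ext; try exact: tens_linear.
by move=> x y hx hy; rewrite !tens_tmul // gh.
Qed.

Lemma tens_sum p n (f : tensor A -> tensor A) (J : eqType) (r : seq J)
    (g : J -> tensor A -> tensor A) : linear f -> (forall q, linear (g q)) ->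
  {in homog (p + n), forall x,
    tens p f (fun y => \sum_(q <- r) g q y) x = \sum_(q <- r) tens p f (g q) x}.
Proof.
move=> lf lg; have ls := linear_bigsum r lg.
apply: tens_ext; first exact: tens_linear.
  by apply: linear_bigsum => q; apply: tens_linear.
move=> x y hx hy; rewrite tens_tmul //.
have -> : \sum_(q <- r) g q y = \sum_(q <- r) 1 *: g q y.
  by apply: eq_bigr => q _; rewrite scale1r.
rewrite (linear_comb _ _ _ (tmul_linearr (f x))).
by apply: eq_bigr => q _; rewrite tens_tmul // scale1r.
Qed.

Lemma tens_sigmas p n (f g : tensor A -> tensor A) ks : linear f -> linear g ->
  all (fun k => k.+2 <= n)%N ks ->
  {in homog (p + n), forall x,
    tens p f g (sigmas sigma [seq (p + k)%N | k <- ks] x) =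
    tens p f (g \o sigmas sigma ks) x}.
Proof.
move=> lf lg hks; have lS := sigmas_linear sigma.
have lgS : linear (g \o sigmas sigma ks) by exact: linear_comp.
apply: (@tens_ext _ _ p n (tens p f g \o sigmas sigma _)).
- by apply: linear_comp (lS _); apply: tens_linear.
- exact: tens_linear.
by move=> x y hx hy /=; rewrite (sigmas_shift _ hks) // !tens_tmul.
Qed.

Lemma tens_braid i n :
  {in homog (i.+1 + n), tens i.+1 (braid sigma i 1) id =1 sigmas sigma (iota 0 i)}.
Proof.
have lb := braid_linear; have lS := sigmas_linear sigma.
apply: tens_ext => //; first exact: tens_linear.
move=> x y hx hy; rewrite tens_tmul // braid1E // (@sigmas_left _ _ _ i.+1) //.
by apply/allP => k; rewrite mem_iota add0n ltnS.
Qed.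

(** T_{(w,S)} expressed by the pair (bits w, cp(S)). *)
Definition stuffle_term (q : bitseq * seq nat) x : tensor A :=
  mcomp m q.2 (sigmas sigma (sorting_word q.1) x).

Lemma stuffle_term_linear q : linear (stuffle_term q).
Proof. exact: linear_comp (mcomp_linear _) (sigmas_linear _ _). Qed.

Lemma sorting_word_bound b : all (fun k => k.+2 <= size b)%N (sorting_word b).
Proof. exact: sorts_bound (sorts_sorting_word b). Qed.

Lemma stuffles_size i j q : q \in stuffles i j ->
  count id q.1 = i /\ size q.1 = (i + j)%N.
Proof.
case: q => b I; rewrite mem_stuffles => /and3P[_ /eqP <- /eqP <-].
by rewrite -(count_predC id b).
Qed.

(** With b the remaining bits and I the remaining entries, the terms for (1b, 1I),
    (0b, 1I) and (10b, 2I) are id (x) T, (id (x) T)(beta_{i,1} (x) id) and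
    (m (x) T)(id (x) beta_{i-1,1} (x) id), where T is the term for (b, I), as the
    sorting words of 1b, 0b and 10b show. *)
Lemma qshuffle_deg_stuffles i j :
  {in homog (i + j), forall x,
    qshuffle_deg m sigma i j x = \sum_(q <- stuffles i j) stuffle_term q x}.
Proof.
have lt := stuffle_term_linear; have lM := mcomp_linear; have lT := mT_linear m.
have mcomp1 n : {in homog n, mcomp m (nseq n 1%N) =1 id}.
  elim: n => [|n IH] //.
  have -> : mcomp m (nseq n.+1 1%N) = tens 1 id (mcomp m (nseq n 1%N)) by [].
  apply: (@tens_ext _ _ 1 n); [exact: tens_linear | exact: id_linear |].
  by move=> x y hx hy; rewrite tens_tmul // IH.
have sw0 n : sorting_word (nseq n false) = [::].
  by elim: n => //= n ->; rewrite count_nseq.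
have sw1 n : sorting_word (nseq n true) = [::] by elim: n => //= n ->.
elim: i j => [|i IHi] j.
  by move=> x hx; rewrite big_seq1 /stuffle_term sw0 mcomp1.
elim: j => [|j IHj] x hx.
  rewrite addn0 in hx; rewrite big_seq1 -[LHS](mcomp1 _ _ hx).
  by rewrite -[X in mcomp _ _ X]/(sigmas sigma [::] x) -(sw1 i.+1).
have -> : qshuffle_deg m sigma i.+1 j.+1 x =
    tens 1 id (qshuffle_deg m sigma i j.+1) x +
    tens 1 id (qshuffle_deg m sigma i.+1 j) (tens i.+2 (braid sigma i.+1 1) id x) +
    tens 2 (mT m) (qshuffle_deg m sigma i j)
          (tens 1 id (tens i.+1 (braid sigma i 1) id) x) by [].
have -> : stuffles i.+1 j.+1 =
    [seq (true :: q.1, 1%N :: q.2) | q <- stuffles i j.+1] ++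
    [seq (false :: q.1, 1%N :: q.2) | q <- stuffles i.+1 j] ++
    [seq ([:: true, false & q.1], 2%N :: q.2) | q <- stuffles i j] by [].
have lq := qshuffle_deg_linear.
rewrite !big_cat !big_map /= addrA; congr (_ + _ + _).
- rewrite (@tens_congr 1 (i + j.+1) _ _ _ _ _ _ (IHi j.+1)) //; last first.
    exact: linear_bigsum.
  rewrite (@tens_sum 1 (i + j.+1)) //.
  apply: eq_big_seq => q /stuffles_size[_ szq]; rewrite /stuffle_term /=.
  by rewrite (@tens_sigmas 1 (i + j.+1)) // -szq sorting_word_bound.
- have hx2 : x \in homog (i.+2 + j) by rewrite addSnnS.
  rewrite (tens_braid hx2).
  have : sigmas sigma (iota 0 i.+1) x \in homog (1 + (i.+1 + j)).
    apply: homog_sigmas => //.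
    by apply/allP => k; rewrite mem_iota; lia.
  move=> hx'.
  rewrite (@tens_congr 1 (i.+1 + j) _ _ _ _ _ _ IHj) //; last first.
    exact: linear_bigsum.
  rewrite (@tens_sum 1 (i.+1 + j)) //.
  apply: eq_big_seq => q /stuffles_size[cq szq]; rewrite /stuffle_term /= cq.
  by rewrite sigmas_cat (@tens_sigmas 1 (i.+1 + j)) // -szq sorting_word_bound.
have hx2 : x \in homog (1 + (i.+1 + j)) by rewrite addnS in hx.
have lb := braid_linear; have lS := sigmas_linear sigma.
rewrite (@tens_congr 1 (i.+1 + j) _ _ _ _ _ _ (@tens_braid i j)) //; last first.
  exact: tens_linear.
have bnd : all (fun k => k.+2 <= i.+1 + j)%N (iota 0 i).
  by apply/allP => k; rewrite mem_iota; lia.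
have -> : tens 1 id (sigmas sigma (iota 0 i)) x =
    sigmas sigma [seq (1 + k)%N | k <- iota 0 i] x.
  apply: (@tens_ext _ _ 1 (i.+1 + j)) hx2 => //; first exact: tens_linear.
  by move=> y z hy hz; rewrite (sigmas_shift _ bnd) // tens_tmul.
have hx3 : sigmas sigma (map S (iota 0 i)) x \in homog (2 + (i + j)).
  have -> : (2 + (i + j) = 1 + (i.+1 + j))%N by lia.
  apply: homog_sigmas hx2; apply/allP => k; rewrite -(iotaDl 1) mem_iota; lia.
rewrite (@tens_congr 2 (i + j) _ _ _ _ _ _ (IHi j)) //; last first.
  exact: linear_bigsum.
rewrite (@tens_sum 2 (i + j)) //.
apply: eq_big_seq => q /stuffles_size[cq szq]; rewrite /stuffle_term /= cq.
rewrite map_cat -map_comp sigmas_cat.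
by rewrite (@tens_sigmas 2 (i + j)) // -szq sorting_word_bound.
Qed.

End Product.

Theorem theorem4p1 (K : fieldType) (charK : [pchar K] =i pred0)
    (A : lmodType K) (m : {linear tpow A 2 -> A})
    (sigma : {linear tpow A 2 -> tpow A 2})
    (hA : braided_algebra m sigma)
    (i j : nat) (hi : (0 < i)%N) (hj : (0 < j)%N) (a : 'I_(i + j) -> A) :
  qshuffle m sigma
    (pure [seq a (lshift j r) | r <- enum 'I_i])
    (pure [seq a (rshift i r) | r <- enum 'I_j]) =
  \sum_(p in mixable i j)
    Tmix m sigma p (pure [seq a r | r <- enum 'I_(i + j)]).
Proof.
set u := [seq a (lshift j r) | r <- enum 'I_i].
set v := [seq a (rshift i r) | r <- enum 'I_j].
have su : size u = i by rewrite size_map size_enum_ord.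
have sv : size v = j by rewrite size_map size_enum_ord.
have uvE : [seq a r | r <- enum 'I_(i + j)] = u ++ v.
  apply: (@eq_from_nth _ (a (lshift j (Ordinal hi)))).
    by rewrite size_cat su sv size_map size_enum_ord.
  move=> l; rewrite size_map size_enum_ord => lt_l.
  rewrite (nth_map (Ordinal lt_l)) ?size_enum_ord // nth_cat su.
  case: ltnP => [lt_li|le_il].
    rewrite (nth_map (Ordinal lt_li)) ?size_enum_ord //; congr a.
    by apply: val_inj; rewrite /= !nth_enum_ord.
  have lt_lj : (l - i < j)%N by lia.
  rewrite (nth_map (Ordinal lt_lj)) ?size_enum_ord //; congr a.
  by apply: val_inj; rewrite /= !nth_enum_ord // subnKC.
have lq := qshuffle_deg_linear m sigma.
have -> : qshuffle m sigma (pure u) (pure v) =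
    qshuffle_deg m sigma i j (pure (u ++ v)).
  have ml (u1 u2 : seq A) : multilinear (fun v' => qshuffle_deg m sigma
      (size u1) (size v') (pure (u2 ++ v'))).
    move=> v1 v2 c y z; rewrite !size_cat /= catA pure_multilinear lq.
    by rewrite -!catA.
  rewrite /qshuffle tlift_pure; first by rewrite tlift_pure // su sv.
  move=> u1 u2 c y z; rewrite !tlift_pure // !size_cat /= -!catA !cat_cons.
  by rewrite pure_multilinear lq.
rewrite uvE; set x := pure (u ++ v).
have hx : x \in homog (i + j) by rewrite -su -sv -size_cat homog_pure.
rewrite (qshuffle_deg_stuffles _ _ hx).
rewrite -(sum_mixable i j (fun q => stuffle_term m sigma q x)).
apply: eq_bigr => p; rewrite inE => /andP[sh _].
by rewrite /Tmix /stuffle_term /= Tperm_bits.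
Qed.
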